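(* Let $r$ be a positive integer, let $P$ be an $r$-differential poset, and let $n,k\in\mathbb{N}=\{0,1,2,\dots\}$. Then for every $x\in P_n$, $$e(x)\,(rn)^k=\sum_{y\in P_n} m_k(x\rightarrow y)\,e(y).$$
   Context: Let $r\ge 1$ be an integer. A poset $P$ is called $r$-differential if: (D1) $P$ is locally finite, graded, and has a minimum element $\hat 0$; (D2) if $x\neq y$ in $P$ and there are exactly $k$ elements of $P$ covered by both $x$ and $y$, then there are exactly $k$ elements of $P$ which cover both $x$ and $y$; (D3) if $x\in P$ covers exactly $k$ elements of $P$, then $x$ is covered by exactly $k+r$ elements of $P$. Let $\rho$ be the rank function of $P$ (with $\rho(\hat 0)=0$, and $\rho(y)=\rho(x)+1$ whenever $y$ covers $x$), and let $P_n=\{x\in P:\rho(x)=n\}$. For $x\in P$, $e(x)$ denotes the number of saturated chains from $\hat 0$ to $x$ (so $e(\hat 0)=1$). For $x,y\in P_n$, a down-up alternating walk of length $2k$ from $x$ to $y$ is a sequence $x=y_0\ge y_{1/2}\le y_1\ge y_{3/2}\le y_2\ge\cdots\ge y_{k-1/2}\le y_k=y$ of elements of $P$ such that any two consecutive elements are adjacent in the Hasse diagram of $P$ (so $y_i\in P_n$ and $y_{i+1/2}\in P_{n-1}$ for integers $i$). $m_k(x\rightarrow y)$ denotes the number of such walks. The convention $0^0=1$ is used. *)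

(* Defs.v *)
From mathcomp Require Import all_boot all_order finmap.
From mathcomp Require Import boolp classical_sets functions cardinality fsbigop.

Set Implicit Arguments.
Unset Strict Implicit.
Unset Printing Implicit Defensive.

Import Order.TTheory.
Local Open Scope order_scope.
Local Open Scope classical_set_scope.
Local Open Scope card_scope.

(* [covered_by x y]: y covers x *)
Definition covered_by (d : Order.disp_t) (T : porderType d) : rel T :=
  fun x y => (x < y) && `[< forall z : T, ~~ (x < z < y) >].

Definition lower_covers (d : Order.disp_t) (T : porderType d) (x : T) : set T :=
  [set z | covered_by z x].

Definition upper_covers (d : Order.disp_t) (T : porderType d) (x : T) : set T :=
  [set z | covered_by x z].

Definition locally_finite (d : Order.disp_t) (T : porderType d) : Prop :=
  forall x y : T, finite_set [set z | x <= z <= y].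

Definition rank_function (d : Order.disp_t) (T : bPOrderType d)
    (rho : T -> nat) : Prop :=
  rho \bot = 0%N /\ forall x y : T, covered_by x y -> rho y = (rho x).+1.

Definition graded (d : Order.disp_t) (T : bPOrderType d) : Prop :=
  exists rho : T -> nat, rank_function rho.

(* The minimum element is the bottom \bot of the bPOrderType structure. *)
Record differential_poset (r : nat) (d : Order.disp_t) (T : bPOrderType d)
    : Prop := {
  differential_locally_finite : locally_finite T;
  differential_graded : graded T;
  differential_common_covers : forall (x y : T) (k : nat), x != y ->
    lower_covers x `&` lower_covers y #= `I_k ->
    upper_covers x `&` upper_covers y #= `I_k;
  differential_covers : forall (x : T) (k : nat),
    lower_covers x #= `I_k -> upper_covers x #= `I_(k + r)%N }.

Definition rank_level (d : Order.disp_t) (T : bPOrderType d)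
    (rho : T -> nat) (n : nat) : set T :=
  [set x | rho x = n].

(* The chain \bot = c_0 < c_1 < ... < c_m = x is encoded by [:: c_1; ...; c_m],
   so x = \bot has the single chain [::]. *)
Definition saturated_chains (d : Order.disp_t) (T : bPOrderType d) (x : T) :
    set (seq T) :=
  [set c | path (@covered_by d T) \bot c /\ last \bot c = x].

(* [fset_set] is set0 on infinite sets; in a differential poset
   [saturated_chains x] and [down_up_walks k x y] are finite. *)
Definition num_chains (d : Order.disp_t) (T : bPOrderType d) (x : T) : nat :=
  #|` fset_set (saturated_chains x)|%fset.

(* The entry of index j of the tuple w is the element y_(j/2) of the walk;
   the default value of nth is irrelevant, as all indices are in range. *)
Definition down_up_walks (d : Order.disp_t) (T : porderType d)
    (k : nat) (x y : T) : set ((k.*2).+1.-tuple T) :=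
  [set w : (k.*2).+1.-tuple T |
    [/\ nth x w 0 = x,
        nth x w k.*2 = y &
        forall i : nat, (i < k)%N ->
          covered_by (nth x w i.*2.+1) (nth x w i.*2) /\
          covered_by (nth x w i.*2.+1) (nth x w i.+1.*2)]].
Arguments down_up_walks {d T} k x y.

Definition num_walks (d : Order.disp_t) (T : porderType d)
    (k : nat) (x y : T) : nat :=
  #|` fset_set (down_up_walks k x y)|%fset.

(* Main.v *)
Require Import Defs.
From mathcomp Require Import all_boot all_order finmap.
From mathcomp Require Import boolp classical_sets functions cardinality fsbigop.

(** Let A be the operator that steps down from rank n to rank n-1 along a cover
    and then back up to rank n.  The number m_k(x -> y) is the (x,y) entry of the
    k-th power of A, so the theorem is the k-th iterate of one eigenvalue
    equation: the vector of the numbers e(y), for y of rank n, is an eigenvector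
    of A with eigenvalue rn ([num_chains_eigenvector], iterated in
    [num_walks_eigenvector]).

    The eigenvalue equation splits into two one-step identities:
      - the numbers e(z), over the lower covers z of x, add up to e(x), by
        dropping the last element of a saturated chain ([num_chains_sum_lower]);
      - the numbers e(y), over the upper covers y of z, add up to
        r (rho(z) + 1) e(z) ([num_chains_sum_upper]).

    The second one is Stanley's commutation relation DU - UD = rI applied to e.
    Axioms (D2) and (D3) say together that two elements z, w of equal rank have
    as many common upper covers as common lower covers, plus r if z = w
    ([common_upper_covers]).  Hence going up from z and then down gives the same
    sum as going down and then up, plus r e(z).  By induction on the rank, going
    down and then up gives r rho(z) e(z), and the total is r (rho(z) + 1) e(z).

    Every sum ranges over a whole rank level, filtered by the covering relation,
    so that double sums can be exchanged freely.  The levels are finite: each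
    element has finitely many upper covers by (D3), and the elements of rank n+1
    are upper covers of elements of rank n.  Sums over the lower covers of an
    element of rank n are filtered from level n.-1 even if n = 0: such a sum is
    then empty, as it should be, since the minimum covers nothing. *)

Set Implicit Arguments.
Unset Strict Implicit.
Unset Printing Implicit Defensive.

Import Order.TTheory.
Local Open Scope order_scope.
Local Open Scope classical_set_scope.
Local Open Scope card_scope.

(** * Counting finite sets *)

(** Both chains and walks are counted by cutting off one end: what is cut off is
    the index [i] of a fiber, and what remains is an element of [B i]. *)
Lemma card_fset_set_fibers (I : eqType) (V W : choiceType) (s : seq I)
    (B : I -> set W) (f : I -> W -> V) (A : set V) :
  uniq s -> (forall i, i \in s -> finite_set (B i)) ->
  (forall i j v w, B i v -> B j w -> f i v = f j w -> i = j /\ v = w) ->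
  (forall v, A v <-> exists i w, [/\ i \in s, B i w & v = f i w]) ->
  finite_set A /\
  #|` fset_set A|%fset = (\sum_(i <- s) #|` fset_set (B i)|%fset)%N.
Proof.
move=> us finB injf AE.
pose t := [seq f i w | i <- s, w <- enum_fset (fset_set (B i))].
have memB i w : i \in s -> (w \in enum_fset (fset_set (B i))) = (w \in B i).
  by move=> si; rewrite -(in_fset_set (finB i si)).
have tA v : A v <-> v \in t.
  rewrite AE; split.
    move=> [i [w [si Bw ->]]]; apply/allpairsPdep; exists i, w; split=> //.
    by rewrite memB// inE.
  move=> /allpairsPdep[i [w [si +  ->]]]; rewrite memB// inE => Bw.
  by exists i, w.
have ut : uniq t.
  apply: allpairs_uniq_dep => //.
  move=> _ _ /allpairsPdep[i [w [si Bw ->]]] /allpairsPdep[j [v [sj Bv ->]]] /=.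
  rewrite memB// inE in Bw; rewrite memB// inE in Bv.
  by move=> /(injf _ _ _ _ Bw Bv)[-> ->].
have finA : finite_set A.
  by apply/finite_seqP; exists t; apply/seteqP; split=> v /tA.
split=> //; have -> : size (enum_fset (fset_set A)) = size t.
  apply/perm_size/uniq_perm => // v; rewrite in_fset_set//.
  by apply/idP/idP => [|/tA]; rewrite inE// => /tA.
by rewrite size_allpairs_dep sumnE big_map.
Qed.

(** Translates the cardinals of axioms (D2) and (D3) into filtered sums. *)
Lemma card_pred_sum (T : choiceType) (X : {fset T}) (P : pred T) (k : nat) :
  (forall y, P y -> y \in X) ->
  [set y | P y] #= `I_k <-> (\sum_(y <- X | P y) 1)%N = k.
Proof.
move=> PX; have -> : [set y | P y] = [set` [fset y in X | P y]%fset].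
  apply/seteqP; split=> y /=; rewrite !inE/=; last by case/andP.
  by move=> Py; apply/andP; split; first exact: PX.
have <- : #|` [fset y in X | P y]|%fset = (\sum_(y <- X | P y) 1)%N.
  by rewrite card_fset_sum1 big_fset.
by split=> /card_eq_fsetP.
Qed.

(** * Graded locally finite posets *)

Section GradedPoset.

Context (d : Order.disp_t) (T : bPOrderType d) (rho : T -> nat).
Hypothesis lfT : locally_finite T.
Hypothesis rhoP : rank_function rho.

Lemma covered_by_lt (x y : T) : covered_by x y -> x < y.
Proof. by case/andP. Qed.

Lemma covered_by_rank (x y : T) : covered_by x y -> rho y = (rho x).+1.
Proof. by case: rhoP => _; apply. Qed.

Lemma covered_by_bot (x : T) : covered_by x \bot = false.
Proof. by apply/negP => /covered_by_lt; rewrite ltx0. Qed.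

Lemma finite_lower_covers (x : T) : finite_set (lower_covers x).
Proof.
apply: sub_finite_set (lfT \bot x) => z /covered_by_lt /ltW zx /=.
by rewrite le0x.
Qed.

(** In a finite interval one can climb from [y] until the next step is [x]. *)
Lemma exists_lower_cover_above (x y : T) :
  y < x -> exists2 z, y <= z & covered_by z x.
Proof.
have [m] := ubnP #|` fset_set [set z | y <= z <= x]|%fset.
elim: m y => // m IHm y; rewrite ltnS => cardm yx.
have [cyx|] := boolP (covered_by y x); first by exists y.
rewrite /covered_by yx => /asboolPn/existsNP[w /negP/negPn/andP[yw wx]].
case: (IHm w _ wx) => [|z wz zx]; last first.
  by exists z => //; exact: le_trans (ltW yw) wz.
apply: leq_trans cardm; apply: fproper_ltn_card.
have memI u v : (v \in fset_set [set z | u <= z <= x]) = (u <= v <= x).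
  by rewrite in_fset_set; [apply/idP/idP; rewrite inE | exact: lfT].
rewrite fproperE; apply/andP; split.
  apply/fsubsetP => z; rewrite !memI => /andP[wz ->].
  by rewrite (le_trans (ltW yw) wz).
by apply/fsubsetP => /(_ y); rewrite !memI lexx (ltW yx) lt_geF// => /(_ isT).
Qed.

Lemma rank_eq0 (x : T) : (rho x == 0%N) = (x == \bot).
Proof.
have [->|x0] := eqVneq x \bot; first by case: rhoP => -> _.
have [z _ zx] : exists2 z, \bot <= z & covered_by z x.
  by apply: exists_lower_cover_above; rewrite lt0x.
by rewrite (covered_by_rank zx).
Qed.

Local Notation level n := (fset_set (rank_level rho n)).

Lemma saturated_chains_bot : saturated_chains (\bot : T) = [set [::]].
Proof.
apply/seteqP; split=> [c|_ ->] //; case/lastP: c => // c y [].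
rewrite rcons_path last_rcons => /andP[_ + yb].
by rewrite yb covered_by_bot.
Qed.

Lemma saturated_chains_rcons (x : T) (c : seq T) : x != \bot ->
  saturated_chains x c <->
  exists z c', [/\ covered_by z x, saturated_chains z c' & c = rcons c' x].
Proof.
move=> x0; split.
  case/lastP: c => [[_ /= b]|c y []]; first by rewrite b eqxx in x0.
  rewrite rcons_path last_rcons => /andP[pc cy] <-.
  by exists (last \bot c), c.
move=> [z [c' [zx [pc lc] ->]]]; split; last by rewrite last_rcons.
by rewrite rcons_path pc lc.
Qed.

Hypothesis fin_level : forall n, finite_set (rank_level rho n).

Lemma mem_level (n : nat) (x : T) : (x \in level n) = (rho x == n).
Proof. by rewrite in_fset_set//; apply/idP/eqP; rewrite inE. Qed.

Lemma mem_level_pred (z x : T) : covered_by z x -> z \in level (rho x).-1.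
Proof. by move=> /covered_by_rank ->; rewrite mem_level. Qed.

(** Finiteness and the recursion come from the same decomposition of chains by
    their last element but one, so a single induction yields both. *)
Lemma finite_saturated_chains (x : T) : finite_set (saturated_chains x) /\
  (x != \bot -> num_chains x =
    \sum_(z <- level (rho x).-1 | covered_by z x) num_chains z)%N.
Proof.
have [m] := ubnP (rho x); elim: m x => // m IHm x; rewrite ltnS => xm.
have [->|x0] := eqVneq x \bot.
  by rewrite saturated_chains_bot; split.
pose s := [seq z <- enum_fset (level (rho x).-1) | covered_by z x].
have [||||] := @card_fset_set_fibers _ _ _ s (@saturated_chains d T)
                 (fun=> rcons^~ x) (saturated_chains x).
- by rewrite filter_uniq ?fset_uniq.
- move=> z; rewrite mem_filter => /andP[zx _].
  by have [] := IHm z; first by rewrite -ltnS -(covered_by_rank zx).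
- by move=> z w c c' [_ <-] [_ <-] /rcons_inj[->].
- move=> c; rewrite saturated_chains_rcons//.
  split=> [[z [c' [zx zc ->]]]|[z [c' [+ zc ->]]]].
    by exists z, c'; rewrite mem_filter zx mem_level_pred.
  by rewrite mem_filter => /andP[zx _]; exists z, c'.
by move=> finx cardx; split=> // _; rewrite /num_chains cardx big_filter.
Qed.

Lemma num_chains_sum_lower (x : T) : x != \bot ->
  num_chains x =
  (\sum_(z <- level (rho x).-1 | covered_by z x) num_chains z)%N.
Proof. by case: (finite_saturated_chains x). Qed.

(** * Walks *)

Lemma down_up_walks0 (x y : T) :
  down_up_walks 0 x y = [set w | x = y /\ w = [tuple x]].
Proof.
apply/seteqP; split=> [w [/= wx wy _]|w [<- ->]]; last by split.
split; first by rewrite -wx -wy.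
by case/tupleP: w wx wy => a w /= <- _; rewrite tuple0.
Qed.

Lemma num_walks0 (x y : T) : num_walks 0 x y = (x == y) :> nat.
Proof.
rewrite /num_walks down_up_walks0; have [->|xy] := eqVneq x y.
  have -> : [set w | y = y /\ w = [tuple y]] = [set [tuple y]].
    by apply/seteqP; split=> w // [].
  by rewrite fset_set1 cardfs1.
have -> : [set w | x = y /\ w = [tuple x]] = set0.
  by apply/seteqP; split=> w // [/eqP]; rewrite (negPf xy).
by rewrite fset_set0 cardfs0.
Qed.

Lemma down_up_walksS (k : nat) (x y : T) (w : (k.+1.*2).+1.-tuple T) :
  down_up_walks k.+1 x y w <->
  exists z x' (w' : (k.*2).+1.-tuple T),
    [/\ covered_by z x, covered_by z x', down_up_walks k x' y w'
      & w = [tuple of x :: z :: w']].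
Proof.
split.
  case/tupleP: w => a w; case/tupleP: w => z w [/= ax wy cov].
  have [za zw] := cov 0%N isT; rewrite /= in za zw.
  subst a; exists z, (nth x w 0), w; split=> //.
  (* The remaining walk starts at another element, the default value of nth. *)
  have nthE i : (i <= k.*2)%N -> nth (nth x w 0) w i = nth x w i.
    by move=> ik; apply: set_nth_default; rewrite size_tuple.
  rewrite /down_up_walks /=; split; rewrite ?nthE//.
  move=> i ik; have ik2 : (i.*2.+1 < k.*2)%N by rewrite ltn_Sdouble.
  have := cov i.+1 ik; rewrite /= !nthE ?(ltnW ik2) ?(ltnW (ltnW ik2))//; exact.
move=> [z [x' [w' [zx zx' [w'x' w'y cov] ->]]]].
have nthE i : (i <= k.*2)%N -> nth x w' i = nth x' w' i.
  by move=> ik; apply: set_nth_default; rewrite size_tuple.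
split=> //=; first by rewrite nthE.
case=> [_|i ik] /=; first by rewrite nthE// w'x'.
have ik2 : (i.*2.+1 < k.*2)%N by rewrite ltn_Sdouble.
have := cov i ik; rewrite /= !nthE ?(ltnW ik2) ?(ltnW (ltnW ik2))//; exact.
Qed.

(** As for chains: a longer walk splits into its first two steps and a walk that
    is one round shorter, which yields finiteness and the recursion together. *)
Lemma finite_down_up_walks (k : nat) (x y : T) :
  finite_set (down_up_walks k x y) /\
  ((0 < k)%N -> num_walks k x y =
    \sum_(z <- level (rho x).-1 | covered_by z x)
      \sum_(x' <- level (rho x) | covered_by z x') num_walks k.-1 x' y)%N.
Proof.
elim: k x => [|k IHk] x.
  split=> //; rewrite down_up_walks0.
  by apply: (@sub_finite_set _ _ [set [tuple x]]) => // w [].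
pose s := [seq (z, x') | z <- [seq z <- enum_fset (level (rho x).-1)
                                | covered_by z x],
                         x' <- [seq x' <- enum_fset (level (rho x))
                                | covered_by z x']].
have [||||] := @card_fset_set_fibers _ _ _ s
    (fun p => down_up_walks k p.2 y)
    (fun p w => [tuple of x :: p.1 :: w] : (k.+1.*2).+1.-tuple T)
    (down_up_walks k.+1 x y).
- apply: allpairs_uniq_dep; rewrite ?filter_uniq ?fset_uniq//.
    by move=> z _; rewrite filter_uniq ?fset_uniq.
  by move=> [z1 z2] [w1 w2] _ _ /= [-> ->].
- by move=> [z x'] _; have [] := IHk x'.
- move=> [z1 x1] [z2 x2] w1 w2 [/= w1x _ _] [/= w2x _ _].
  move=> /(congr1 val)/= [-> /val_inj w12]; split=> //; congr pair.
  (* The middle index x' is the first element of the remaining walk. *)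
  by rewrite -w1x -w2x w12; apply: set_nth_default; rewrite size_tuple.
- move=> w; rewrite down_up_walksS.
  split=> [[z [x' [w' [zx zx' ww ->]]]]|[[z x'] [w' [+ ww ->]]]].
    exists (z, x'), w'; split=> //; apply/allpairsPdep; exists z, x'.
    rewrite !mem_filter zx zx' mem_level_pred// mem_level.
    by rewrite (covered_by_rank zx) (covered_by_rank zx') eqxx.
  move=> /allpairsPdep[z1 [x1 [z1P x1P [zE xE]]]]; subst z1 x1.
  move: z1P x1P; rewrite !mem_filter => /andP[zx _] /andP[zx' _].
  by exists z, x', w'.
move=> finw cardw; split=> // _; rewrite /num_walks cardw big_allpairs_dep.
by rewrite big_filter; apply: eq_bigr => z _; rewrite big_filter.
Qed.

Lemma num_walksS (k : nat) (x y : T) :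
  num_walks k.+1 x y =
  (\sum_(z <- level (rho x).-1 | covered_by z x)
     \sum_(x' <- level (rho x) | covered_by z x') num_walks k x' y)%N.
Proof. by case: (finite_down_up_walks k.+1 x y) => _ ->. Qed.

(** The recursion for walks applies A once more on the left, and A commutes with
    the scalar [c], so induction on [k] only needs to exchange sums. *)
Lemma num_walks_eigenvector (n k c : nat) (e : T -> nat) :
  (forall x, rho x = n ->
    (\sum_(z <- level n.-1 | covered_by z x)
       \sum_(x' <- level n | covered_by z x') e x' = c * e x)%N) ->
  forall x, rho x = n ->
    (\sum_(y <- level n) num_walks k x y * e y = e x * c ^ k)%N.
Proof.
move=> eig; elim: k => [|k IHk] x xn.
  rewrite muln1 (big_fsetD1 x) ?mem_level ?xn//= num_walks0 eqxx mul1n.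
  rewrite big_seq big1 ?addn0// => y; rewrite !inE => /andP[yx _].
  by rewrite num_walks0 eq_sym (negPf yx).
under eq_bigr => y _ do rewrite num_walksS big_distrl /= xn.
rewrite exchange_big /= expnS mulnA [(e x * c)%N]mulnC -eig// big_distrl /=.
apply: eq_bigr => z zx.
under eq_bigr => y _ do rewrite big_distrl /=.
rewrite exchange_big /= big_distrl /= big_seq_cond [RHS]big_seq_cond.
by apply: eq_bigr => x' /andP[]; rewrite mem_level => /eqP x'n _; rewrite IHk.
Qed.

End GradedPoset.

(** * Differential posets *)

Section DifferentialPoset.

Context (r : nat) (d : Order.disp_t) (T : bPOrderType d) (rho : T -> nat).
Hypothesis diffT : differential_poset r T.
Hypothesis rhoP : rank_function rho.

Let lfT : locally_finite T := differential_locally_finite diffT.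

Local Notation level n := (fset_set (rank_level rho n)).

Lemma finite_rank_level (n : nat) : finite_set (rank_level rho n).
Proof.
elim: n => [|n IHn].
  apply: (@sub_finite_set _ _ [set \bot]) => // x /eqP.
  by rewrite (rank_eq0 lfT rhoP) => /eqP.
apply: (@sub_finite_set _ _
         (\bigcup_(z in rank_level rho n) upper_covers z)).
  move=> x xn; have [z _ zx] : exists2 z, \bot <= z & covered_by z x.
    apply: (exists_lower_cover_above lfT).
    by rewrite lt0x -(rank_eq0 lfT rhoP) xn.
  exists z => //; move: xn.
  by rewrite /rank_level /= (covered_by_rank rhoP zx) => -[].
apply: bigcup_finite => // z _.
have [k lk] := finite_lower_covers lfT z.
by exists (k + r)%N; apply: (differential_covers diffT).
Qed.

(** Axioms (D2) and (D3) in one formula, the matrix form of DU - UD = rI. *)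
Lemma common_upper_covers (n : nat) (z w : T) : rho z = n -> rho w = n ->
  (\sum_(y <- level n.+1 | covered_by z y && covered_by w y) 1 =
   \sum_(v <- level n.-1 | covered_by v z && covered_by v w) 1
   + (z == w) * r)%N.
Proof.
move=> zn wn; set k := (\sum_(v <- level n.-1 | _) 1)%N.
have down v : covered_by v z && covered_by v w -> v \in level n.-1.
  by move=> /andP[vz _]; rewrite -zn (mem_level_pred rhoP finite_rank_level).
apply/card_pred_sum => [y /andP[zy _]|].
  by rewrite (mem_level finite_rank_level) (covered_by_rank rhoP zy) zn.
have lk : [set v | covered_by v z && covered_by v w] #= `I_k.
  exact/(card_pred_sum _ down).
have setE (P Q : pred T) :
    [set v | P v && Q v] = [set v | P v] `&` [set v | Q v].
  by apply/seteqP; split=> v /= => [/andP|[-> ->]].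
rewrite setE; rewrite setE in lk; have [zw|zw] := eqVneq z w.
  by rewrite -zw !setIid mul1n in lk *; exact: (differential_covers diffT).
by rewrite mul0n addn0; apply: (differential_common_covers diffT).
Qed.

(** Replacing each e(y) by the sum over the lower covers of y turns the left side
    into a sum over w weighted by the common upper covers of z and w; the double
    sum on the right is weighted by their common lower covers. *)
Lemma num_chains_up_down (n : nat) (z : T) : rho z = n ->
  (\sum_(y <- level n.+1 | covered_by z y) num_chains y =
   \sum_(v <- level n.-1 | covered_by v z)
     \sum_(w <- level n | covered_by v w) num_chains w
   + r * num_chains z)%N.
Proof.
move=> zn.
transitivity (\sum_(y <- level n.+1 | covered_by z y)
                \sum_(w <- level n | covered_by w y) num_chains w)%N.
  rewrite big_seq_cond [RHS]big_seq_cond; apply: eq_bigr => y.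
  rewrite (mem_level finite_rank_level) => /andP[/eqP yn zy].
  rewrite (num_chains_sum_lower rhoP finite_rank_level) ?yn//.
  by rewrite -(rank_eq0 lfT rhoP) yn.
pose common_up w :=
  (\sum_(y <- level n.+1 | covered_by z y && covered_by w y) 1)%N.
pose common_down w :=
  (\sum_(v <- level n.-1 | covered_by v z && covered_by v w) 1)%N.
transitivity (\sum_(w <- level n) common_up w * num_chains w)%N.
  rewrite (exchange_big_dep xpredT) //=.
  apply: eq_bigr => w _; rewrite big_distrl /=.
  by apply: eq_bigr => v _; rewrite mul1n.
transitivity (\sum_(w <- level n)
                (common_down w * num_chains w + (z == w) * r * num_chains w))%N.
  rewrite big_seq [RHS]big_seq; apply: eq_bigr => w.
  rewrite (mem_level finite_rank_level) => /eqP wn.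
  by rewrite -mulnDl -common_upper_covers.
rewrite big_split /=; congr addn.
  rewrite [RHS](exchange_big_dep xpredT) //=.
  apply: eq_bigr => w _; rewrite big_distrl /=.
  by apply: eq_bigr => v _; rewrite mul1n.
rewrite (big_fsetD1 z) ?(mem_level finite_rank_level) ?zn//= eqxx mul1n.
rewrite big_seq big1 ?addn0// => w; rewrite !inE => /andP[wz _].
by rewrite eq_sym (negPf wz).
Qed.

Lemma num_chains_sum_upper (n : nat) (z : T) : rho z = n ->
  (\sum_(y <- level n.+1 | covered_by z y) num_chains y =
   r * n.+1 * num_chains z)%N.
Proof.
elim: n z => [|n IHn] z zn; rewrite num_chains_up_down//.
  have /eqP -> : z == \bot by rewrite -(rank_eq0 lfT rhoP) zn.
  by rewrite big_pred0 ?add0n ?muln1// => v; rewrite covered_by_bot.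
have -> : (\sum_(v <- level n | covered_by v z)
             \sum_(w <- level n.+1 | covered_by v w) num_chains w
           = \sum_(v <- level n | covered_by v z) r * n.+1 * num_chains v)%N.
  rewrite big_seq_cond [RHS]big_seq_cond; apply: eq_bigr => v.
  by rewrite (mem_level finite_rank_level) => /andP[/eqP vn _]; apply: IHn.
rewrite -big_distrr /= [in RHS](mulnS r) mulnDl addnC; congr (_ + _ * _)%N.
rewrite (num_chains_sum_lower rhoP finite_rank_level (x := z)) ?zn//.
by rewrite -(rank_eq0 lfT rhoP) zn.
Qed.

Lemma num_chains_eigenvector (n : nat) (x : T) : rho x = n ->
  (\sum_(z <- level n.-1 | covered_by z x)
     \sum_(y <- level n | covered_by z y) num_chains y
   = r * n * num_chains x)%N.
Proof.
case: n => [|n] xn.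
  have /eqP -> : x == \bot by rewrite -(rank_eq0 lfT rhoP) xn.
  by rewrite muln0 big_pred0// => v; rewrite covered_by_bot.
rewrite (num_chains_sum_lower rhoP finite_rank_level (x := x)) ?xn; last first.
  by rewrite -(rank_eq0 lfT rhoP) xn.
rewrite big_distrr /= big_seq_cond [RHS]big_seq_cond.
apply: eq_bigr => z; rewrite (mem_level finite_rank_level) => /andP[/eqP zn _].
exact: num_chains_sum_upper.
Qed.

End DifferentialPoset.

Theorem theorem3 (r : nat) (d : Order.disp_t) (T : bPOrderType d)
    (rho : T -> nat) (n k : nat) (x : T) :
  (0 < r)%N ->
  differential_poset r T ->
  rank_function rho ->
  rank_level rho n x ->
  (num_chains x * (r * n) ^ k)%N =
  \big[addn/0%N]_(y \in rank_level rho n) (num_walks k x y * num_chains y)%N.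
Proof.
move=> _ diffT rhoP xn.
have finL := finite_rank_level diffT rhoP.
rewrite fsbig_finite//=; symmetry.
apply: (num_walks_eigenvector rhoP finL k _ xn) => y yn.
exact: num_chains_eigenvector.
Qed.
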